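(* For $n\ge 6$, the chromatic symmetric function $X_{P_{n,v,w}}$ of the path $P_n$ twinned at both leaves $v,w$ satisfies the recurrence $$\frac14X_{P_{n,v,w}}=\frac14\sum_{j=3}^{n-3}(j-1)e_jX_{P_{n-j,v,w}}+(n+2)e_{n+2}+n\,e_{n+1}e_1+3(n-2)e_{n-1}e_3+2(n-3)e_{n-2}e_3e_1+4(n-3)e_{n-2}e_4$$ $$\qquad+e_2\Bigl[\frac14X_{P_{n-2,v,w}}-2e_n-(n-4)e_{n-2}e_2-(n-2)e_{n-1}e_1\Bigr],$$ with the initial conditions $X_{P_{2,v,w}}=24e_4$, $X_{P_{3,v,w}}=4e_3e_2+12e_4e_1+20e_5$, $X_{P_{4,v,w}}=24e_3^2+8e_4e_2+16e_5e_1+24e_6$, $X_{P_{5,v,w}}=16e_3e_3e_1+68e_4e_3+12e_5e_2+20e_6e_1+28e_7$. Moreover, despite the negative terms, the expression on the right-hand side of the recurrence is $e$-positive.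
   Context: The chromatic symmetric function of a finite simple graph $H=(V,E)$ is $X_H=\sum_\kappa\prod_{u\in V}x_{\kappa(u)}$, the sum over all proper colorings $\kappa:V\to\mathbb{Z}_{>0}$. $P_n$ is the path on $n$ vertices. The twin of a graph at a vertex $v$ is obtained by adding a new vertex $v'$ joined to $v$ and to all neighbors of $v$. $P_{n,v,w}$ denotes $P_n$ twinned at its two leaves $v$ and $w$ in succession. $e_i$ is the $i$-th elementary symmetric function; a symmetric function is $e$-positive if its expansion in the basis of elementary symmetric functions has nonnegative coefficients. *)

(* Defs.v *)
From HB Require Import structures.
From mathcomp Require Import all_boot all_order all_algebra all_fingroup.
From mathcomp Require Import mpoly.
From mathcomp Require boolp.
Set Implicit Arguments.
Unset Strict Implicit.
Unset Printing Implicit Defensive.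
Import GRing.Theory.
Local Open Scope ring_scope.

Record sgraph := SGraph {
  vertex :> finType;
  adj : rel vertex;
  adj_sym : forall x y, adj x y = adj y x;
  adj_irr : forall x, adj x x = false }.

Definition path_adj (n : nat) : rel 'I_n :=
  fun i j => (i.+1 == j :> nat) || (j.+1 == i :> nat).

Lemma path_adj_sym n (x y : 'I_n) : path_adj x y = path_adj y x.
Proof. by rewrite /path_adj orbC. Qed.

Lemma path_adj_irr n (x : 'I_n) : path_adj x x = false.
Proof. by rewrite /path_adj orbb; apply/eqP => /esym/n_Sn. Qed.

Definition path_graph (n : nat) : sgraph :=
  SGraph (@path_adj_sym n) (@path_adj_irr n).

(* In the twin of G at v, the new vertex v' is None. *)
Definition twin_adj (G : sgraph) (v : G) : rel (option G) :=
  fun x y =>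
    match x, y with
    | Some a, Some b => adj a b
    | Some a, None | None, Some a => (a == v) || adj v a
    | None, None => false
    end.

Lemma twin_adj_sym (G : sgraph) (v : G) x y :
  twin_adj v x y = twin_adj v y x.
Proof. by case: x y => [a|] [b|] //=; exact: adj_sym. Qed.

Lemma twin_adj_irr (G : sgraph) (v : G) x : twin_adj v x x = false.
Proof. by case: x => //= a; exact: adj_irr. Qed.

Definition twin (G : sgraph) (v : G) : sgraph :=
  @SGraph (option G) (twin_adj v) (@twin_adj_sym G v) (@twin_adj_irr G v).

(* P_{n,v,w}, with leaves v = 0 and w = n - 1.  The value at n = 0, where
   there is no vertex to twin, is a placeholder. *)
Definition twinned_path (n : nat) : sgraph :=
  if n is m.+1 then
    @twin (@twin (path_graph m.+1) (ord0 : 'I_m.+1)) (Some (ord_max : 'I_m.+1))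
  else path_graph 0.

(* The specialization x_N := 0, from rat[x_0, ..., x_N] to
   rat[x_0, ..., x_(N-1)]. *)
Definition kill_last (N : nat) (p : {mpoly rat[N.+1]}) : {mpoly rat[N]} :=
  p \mPo [tuple oapp (fun j : 'I_N => 'X_j) 0 (unlift ord_max i) | i < N.+1].

HB.instance Definition _ N :=
  GRing.RMorphism.copy (@kill_last N) (comp_mpoly _).
HB.instance Definition _ N :=
  GRing.Linear.copy (@kill_last N) (comp_mpoly _).

(* The ring of symmetric functions over rat in countably many variables, as
   the inverse limit (in the category of graded rings, whence the degree
   bound) of the rings of symmetric polynomials: sfproj f N is the image
   f(x_0, ..., x_(N-1), 0, 0, ...). *)
Record symfun := SymFun {
  sfproj : forall N, {mpoly rat[N]};
  sfproj_sym : forall N, sfproj N \is symmetric;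
  sfproj_compat : forall N, kill_last (sfproj N.+1) = sfproj N;
  sfproj_bounded : exists d, forall N, (msize (sfproj N) <= d)%N }.

Lemma symfunP (f g : symfun) : (forall N, sfproj f N = sfproj g N) -> f = g.
Proof.
case: f g => [f f1 f2 f3] [g g1 g2 g3] /= fg.
have E : f = g by apply: boolp.functional_extensionality_dep.
subst g.
by congr SymFun; apply: boolp.Prop_irrelevance.
Qed.

HB.instance Definition _ := boolp.gen_eqMixin symfun.
HB.instance Definition _ := boolp.gen_choiceMixin symfun.

Section Operations.
Implicit Types (f g h : symfun) (c : rat).

Definition sf_const c : symfun.
Proof.
refine (@SymFun (fun N => c%:MP) _ _ _).
- by move=> N; apply/issymP => s; rewrite /msym mmapC.
- by move=> N; rewrite /kill_last comp_mpolyC.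
- by exists 1%N => N; rewrite msizeC leq_b1.
Defined.

Definition sf_add f g : symfun.
Proof.
refine (@SymFun (fun N => sfproj f N + sfproj g N) _ _ _).
- by move=> N; rewrite rpredD ?sfproj_sym.
- by move=> N; rewrite raddfD /= !sfproj_compat.
- have [[a Ha] [b Hb]] := (sfproj_bounded f, sfproj_bounded g).
  exists (maxn a b) => N; apply: leq_trans (msizeD_le _ _) _.
  by rewrite geq_max !leq_max Ha Hb orbT.
Defined.

Definition sf_mul f g : symfun.
Proof.
refine (@SymFun (fun N => sfproj f N * sfproj g N) _ _ _).
- by move=> N; rewrite rpredM ?sfproj_sym.
- by move=> N; rewrite rmorphM /= !sfproj_compat.
- have [[a Ha] [b Hb]] := (sfproj_bounded f, sfproj_bounded g).
  exists (a + b).+1 => N; apply: leq_trans (msizeM_le _ _) _.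
  by rewrite ltnS leq_add.
Defined.

Definition sf_scale c f : symfun.
Proof.
refine (@SymFun (fun N => c *: sfproj f N) _ _ _).
- by move=> N; rewrite rpredZ ?sfproj_sym.
- by move=> N; rewrite /kill_last comp_mpolyZ -/(kill_last _) sfproj_compat.
- have [a Ha] := sfproj_bounded f.
  by exists a => N; apply: leq_trans (msizeZ_le _ _) (Ha N).
Defined.

Definition sf_opp f : symfun := sf_scale (-1) f.

Lemma sf_addA : associative sf_add.
Proof. by move=> f g h; apply: symfunP => N /=; rewrite addrA. Qed.
Lemma sf_addC : commutative sf_add.
Proof. by move=> f g; apply: symfunP => N /=; rewrite addrC. Qed.
Lemma sf_add0 : left_id (sf_const 0) sf_add.
Proof. by move=> f; apply: symfunP => N /=; rewrite mpolyC0 add0r. Qed.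
Lemma sf_addN : left_inverse (sf_const 0) sf_opp sf_add.
Proof.
by move=> f; apply: symfunP => N /=; rewrite scaleN1r addNr mpolyC0.
Qed.
HB.instance Definition _ :=
  GRing.isZmodule.Build symfun sf_addA sf_addC sf_add0 sf_addN.

Lemma sf_mulA : associative sf_mul.
Proof. by move=> f g h; apply: symfunP => N /=; rewrite mulrA. Qed.
Lemma sf_mulC : commutative sf_mul.
Proof. by move=> f g; apply: symfunP => N /=; rewrite mulrC. Qed.
Lemma sf_mul1 : left_id (sf_const 1) sf_mul.
Proof. by move=> f; apply: symfunP => N /=; rewrite mpolyC1 mul1r. Qed.
Lemma sf_mulD : left_distributive sf_mul +%R.
Proof. by move=> f g h; apply: symfunP => N /=; rewrite mulrDl. Qed.
Lemma sf_1neq0 : sf_const 1 != 0.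
Proof.
apply/eqP => /(congr1 (fun f => sfproj f 0)) /= /eqP.
by rewrite mpolyC0 mpolyC1 oner_eq0.
Qed.
HB.instance Definition _ :=
  GRing.Zmodule_isComNzRing.Build symfun
    sf_mulA sf_mulC sf_mul1 sf_mulD sf_1neq0.

Lemma sf_scaleA a b f : sf_scale a (sf_scale b f) = sf_scale (a * b) f.
Proof. by apply: symfunP => N /=; rewrite scalerA. Qed.
Lemma sf_scale1 : left_id 1 sf_scale.
Proof. by move=> f; apply: symfunP => N /=; rewrite scale1r. Qed.
Lemma sf_scaleDr : right_distributive sf_scale +%R.
Proof. by move=> c f g; apply: symfunP => N /=; rewrite scalerDr. Qed.
Lemma sf_scaleDl f : {morph sf_scale^~ f : a b / a + b}.
Proof. by move=> a b; apply: symfunP => N /=; rewrite scalerDl. Qed.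
HB.instance Definition _ :=
  GRing.Zmodule_isLmodule.Build rat symfun
    sf_scaleA sf_scale1 sf_scaleDr sf_scaleDl.

Lemma sf_scaleAl c f g : c *: (f * g) = (c *: f) * g.
Proof. by apply: symfunP => N /=; rewrite scalerAl. Qed.
HB.instance Definition _ :=
  GRing.Lmodule_isLalgebra.Build rat symfun sf_scaleAl.
HB.instance Definition _ := GRing.Lalgebra_isComAlgebra.Build rat symfun.

End Operations.

Lemma kill_lastX N (i : 'I_N.+1) :
  kill_last 'X_i = oapp (fun j : 'I_N => 'X_j) 0 (unlift ord_max i).
Proof. by rewrite /kill_last comp_mpolyXU -tnth_nth tnth_mktuple. Qed.

Lemma kill_last_mwiden N (p : {mpoly rat[N]}) : kill_last (mwiden p) = p.
Proof.
rewrite [in LHS](mpolyE p) (raddf_sum (@mwiden N rat)) /=.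
rewrite (raddf_sum (@kill_last N)) /= [RHS]mpolyE.
apply: eq_bigr => m _; rewrite mwidenZ linearZ /=; congr (_ *: _).
rewrite /mwiden mmapX rmorph_prod /= mpolyXE_id; apply: eq_bigr => i _.
rewrite rmorphXn /= kill_lastX; congr (_ ^+ _).
have -> : widen_ord (leqnSn N) i = lift ord_max i.
  by apply: val_inj; rewrite /= /bump leqNgt ltn_ord.
by rewrite liftK.
Qed.

Definition sf_elem (k : nat) : symfun.
Proof.
refine (@SymFun (fun N => mesym N rat k) _ _ _).
- by move=> N; exact: mesym_sym.
- case: k => [|k] N; first by rewrite !mesym0E rmorph1.
  rewrite mesymSS rmorphD rmorphM /= !kill_last_mwiden kill_lastX.
  by rewrite unlift_none /= mulr0 addr0.
- exists k.+1 => N; rewrite mesymE.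
  apply: leq_trans (mmeasure_sum _ _ _ _) _.
  by apply/bigmax_leqP => h /eqP <-; rewrite msizeX mdeg_mesym1.
Defined.

Definition proper_coloring (G : sgraph) (T : eqType) (kappa : G -> T) : bool :=
  [forall u, forall w, adj u w ==> (kappa u != kappa w)].

Lemma proper_coloring_inj (G : sgraph) (T T' : eqType) (f : T -> T')
    (kappa : G -> T) (kappa' : G -> T') :
  injective f -> (forall u, kappa' u = f (kappa u)) ->
  proper_coloring kappa' = proper_coloring kappa.
Proof.
move=> f_inj E; apply: eq_forallb => u; apply: eq_forallb => w.
by rewrite !E (inj_eq f_inj).
Qed.

(* The image of the series X_G under x_i := 0 for all i >= N: the surviving
   terms are those of the proper colorings with colors among 0, ..., N-1. *)
Definition chromatic_poly (G : sgraph) (N : nat) : {mpoly rat[N]} :=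
  \sum_(kappa : {ffun G -> 'I_N} | proper_coloring kappa)
    \prod_(u : G) 'X_(kappa u).

Lemma chromatic_poly_sym G N : chromatic_poly G N \is symmetric.
Proof.
apply/issymP => s; rewrite /chromatic_poly raddf_sum /=.
pose h (r : 'S_N) (k : {ffun G -> 'I_N}) := [ffun u => r (k u)].
rewrite [RHS](reindex_onto (h s) (h s^-1%g)); last first.
  by move=> k _; apply/ffunP => u; rewrite !ffunE permKV.
apply: eq_big => k.
  have -> : proper_coloring (h s k) = proper_coloring k.
    apply: (@proper_coloring_inj _ _ _ s); first exact: perm_inj.
    by move=> u; rewrite ffunE.
  rewrite -[LHS]andbT; congr (_ && _); apply/esym/eqP/ffunP => u.
  by rewrite !ffunE permK.
move=> _; rewrite rmorph_prod /=; apply: eq_bigr => u _.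
by rewrite ffunE /msym mmapX mmap1U.
Qed.

Lemma chromatic_poly_compat G N :
  kill_last (chromatic_poly G N.+1) = chromatic_poly G N.
Proof.
rewrite /chromatic_poly raddf_sum /=.
pose h (k : {ffun G -> 'I_N}) : {ffun G -> 'I_N.+1} :=
    [ffun u => lift ord_max (k u)].
have h_inj : injective h.
  move=> k k' /ffunP E; apply/ffunP => u.
  by have := E u; rewrite !ffunE => /lift_inj.
have h_proper k : proper_coloring (h k) = proper_coloring k.
  apply: proper_coloring_inj; first exact: (@lift_inj _ ord_max).
  by move=> u; rewrite ffunE.
pose A := [set k : {ffun G -> 'I_N} | proper_coloring k].
pose B : {set {ffun G -> 'I_N.+1}} := h @: A.
rewrite (bigID (mem B)) /= [X in _ + X]big1 ?addr0; last first.
  move=> k /andP [pk kB]; rewrite rmorph_prod /=.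
  have [u /eqP ku|nmax] := pickP (fun u => k u == ord_max).
    by rewrite (bigD1 u) //= kill_lastX ku unlift_none mul0r.
  case/negP: kB.
  have /fin_all_exists [k' Ek] : forall u, exists j, k u = lift ord_max j.
    move=> u; have := nmax u.
    by case: (unliftP ord_max (k u)) => [j -> _|->]; rewrite ?eqxx //; exists j.
  have Ekh : k = h (finfun k') by apply/ffunP => u; rewrite !ffunE Ek.
  by rewrite Ekh imset_f // inE -h_proper -Ekh.
rewrite (eq_bigl (mem B)); last first.
  move=> k /=; apply: andb_idl => /imsetP [k' + ->].
  by rewrite inE h_proper.
rewrite big_imset /=; last by move=> x y _ _; exact: h_inj.
apply: eq_big => [k|k _]; first by rewrite inE.
rewrite rmorph_prod /=; apply: eq_bigr => u _.
by rewrite ffunE kill_lastX liftK.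
Qed.

Lemma chromatic_poly_bounded G :
  exists d, forall N, (msize (chromatic_poly G N) <= d)%N.
Proof.
exists #|G|.+1 => N; apply: leq_trans (msize_sum _ _ _) _.
apply/bigmax_leqP => k _; rewrite mprodXE msizeX ltnS.
by rewrite mdeg_sum (eq_bigr (fun=> 1%N)) ?sum1_card // => u _; rewrite mdeg1.
Qed.

Definition chromatic_sf (G : sgraph) : symfun :=
  SymFun (@chromatic_poly_sym G) (@chromatic_poly_compat G)
         (@chromatic_poly_bounded G).

Definition is_partition (la : seq nat) : bool :=
  sorted geq la && (0%N \notin la).

Definition sf_elem_part (la : seq nat) : symfun := \prod_(i <- la) sf_elem i.

(* s is a finite list of partitions containing the support of the expansion,
   and c gives its coefficients. *)
Definition e_positive (f : symfun) : Prop :=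
  exists (s : seq (seq nat)) (c : seq nat -> rat),
    [/\ uniq s, all is_partition s, (forall la, la \in s -> 0 <= c la) &
        f = \sum_(la <- s) c la *: sf_elem_part la].

Notation "'\e_' k" := (sf_elem k)
  (at level 8, k at level 2, format "'\e_' k") : ring_scope.
Notation "'\XP_' n" := (chromatic_sf (twinned_path n))
  (at level 8, n at level 2, format "'\XP_' n") : ring_scope.

(* Main.v *)
Require Import Defs.
From mathcomp Require Import all_boot all_order all_algebra.
From mathcomp Require Import mpoly ring.
Set Implicit Arguments.
Unset Strict Implicit.
Unset Printing Implicit Defensive.
Import Order.TTheory GRing.Theory Num.Theory.
Local Open Scope ring_scope.

(* In finitely many variables let T be the transfer operator
   (T g)(i) = sum over j <> i of x_j g(j), so that X_{P_n} is the sum over i of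
   x_i (T^(n-1) 1)(i).  A twinned leaf contributes twice the elementary
   polynomial e_2 in the colors other than that of its neighbor, and this is
   the vector T^2 1 - e_2 1.  As T is self-adjoint for the pairing weighted by
   the x_i, for n >= 3

     X_{P_{n,v,w}} = 4 (X_{P_(n+2)} - 2 e_2 X_{P_n} + e_2^2 X_{P_(n-2)}),

   and the recurrence reduces to the one for paths,
   X_{P_n} = n e_n + sum over 2 <= j < n of (j-1) e_j X_{P_(n-j)}.  For
   e-positivity, induction shows that X_{P_{m,v,w}}/4 minus
   (m+2) e_(m+2) + m e_(m+1) e_1 + (m-2) e_m e_2 is e-positive for m >= 3,
   which absorbs the negative terms. *)

(** * Elementary polynomials with some variables removed *)

Section ElementaryOff.
Variables (R : comNzRingType) (I : finType) (x : I -> R).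
Implicit Types (A B : {set I}) (f g : I -> R).

(** This is $e_k$ with the variables indexed by [A] set to 0. Below, $e_k(\hat\imath)$ denotes the
    case where [A] is the singleton of i. *)
Definition elem_off A (k : nat) : R :=
  \sum_(B : {set I} | [disjoint B & A] && (#|B| == k)) \prod_(i in B) x i.

Lemma disjoint_setU1r A B i :
  [disjoint B & i |: A] = (i \notin B) && [disjoint B & A].
Proof.
rewrite !disjoints_subset setCU subsetI -disjoints_subset disjoint_sym.
by rewrite disjoints1.
Qed.

Lemma elem_off0 A : elem_off A 0 = 1.
Proof.
rewrite /elem_off (big_pred1 set0) ?big_set0 // => B /=.
rewrite cards_eq0; apply: andb_idl => /eqP ->.
by rewrite -setI_eq0 set0I.
Qed.

(** Adding i is a bijection from the k-subsets avoiding both i and [A] to the (k+1)-subsets that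
    avoid [A] and contain i. *)
Lemma mul_elem_off A i k : i \notin A ->
  x i * elem_off (i |: A) k =
  \sum_(B : {set I} | [disjoint B & A] && (#|B| == k.+1) && (i \in B))
    \prod_(j in B) x j.
Proof.
move=> iA; rewrite big_distrr /= [RHS](reindex_onto (fun B => i |: B)
  (fun B => B :\ i)) /=; last by move=> B /andP[_ iB]; rewrite setD1K.
apply: eq_big => [B|B /andP[+ _]].
  have [iB|iB] := boolP (i \in B).
    rewrite [X in _ = _ && X](_ : _ = false) ?andbF.
      by rewrite disjoint_setU1r iB.
    by apply/negP => /eqP/setP/(_ i); rewrite !inE eqxx iB.
  rewrite setU1K // eqxx andbT setU11 andbT cardsU1 iB add1n eqSS.
  rewrite disjoint_setU1r iB /=.
  by rewrite ![[disjoint _ & A]]disjoint_sym disjoint_setU1r iA.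
rewrite disjoint_setU1r => /andP[iB _].
by rewrite big_setU1.
Qed.

Lemma elem_off_setU1 A i k : i \notin A ->
  elem_off A k.+1 = elem_off (i |: A) k.+1 + x i * elem_off (i |: A) k.
Proof.
move=> iA; rewrite mul_elem_off // [LHS](bigID (fun B : {set I} => i \in B)).
rewrite addrC; congr (_ + _); apply: eq_bigl => B.
by rewrite disjoint_setU1r andbC andbA.
Qed.

(** Double counting: each (k+1)-subset avoiding [A] arises once for each of its k+1 elements. *)
Lemma sum_mul_elem_off A k :
  \sum_(i | i \notin A) x i * elem_off (i |: A) k =
  k.+1%:R * elem_off A k.+1.
Proof.
rewrite (eq_bigr _ (fun i iA => mul_elem_off k iA)).
rewrite (exchange_big_dep (fun B => [disjoint B & A] && (#|B| == k.+1))) /=.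
  rewrite big_distrr /=; apply: eq_bigr => B /andP[dBA /eqP cB].
  rewrite (eq_bigl (mem B)) ?sumr_const ?cB ?mulr_natl // => i /=.
  rewrite dBA eqxx andb_idl // => iB.
  by rewrite (disjointFr dBA iB).
by move=> i B _ /andP[].
Qed.

Lemma sum_elem_off0 A : \sum_(i | i \notin A) x i = elem_off A 1.
Proof.
rewrite -[RHS]mul1r -[1 in RHS]/(1%:R) -sum_mul_elem_off.
by apply: eq_bigr => i _; rewrite elem_off0 mulr1.
Qed.

(** * The transfer operator, its pairing, and path moments *)

Definition transfer g (i : I) : R := \sum_(j | j != i) x j * g j.

Definition pairing f g : R := \sum_i x i * f i * g i.

Lemma eq_transfer f g : f =1 g -> transfer f =1 transfer g.
Proof. by move=> fg i; apply: eq_bigr => j _; rewrite fg. Qed.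

Lemma transferE g i : transfer g i + x i * g i = \sum_j x j * g j.
Proof. by rewrite [RHS](bigD1 i) //= addrC. Qed.

Lemma transferB (c : R) f g :
  transfer (fun i => f i - c * g i) =1
  (fun i => transfer f i - c * transfer g i).
Proof.
move=> i; rewrite /transfer big_distrr -sumrB.
by apply: eq_bigr => j _; rewrite /=; ring.
Qed.

Lemma iter_transferB (c : R) f g m :
  iter m transfer (fun i => f i - c * g i) =1
  (fun i => iter m transfer f i - c * iter m transfer g i).
Proof.
elim: m => // m IH i /=; rewrite (eq_transfer IH).
exact: transferB.
Qed.

Lemma pairing_sym f g : pairing f g = pairing g f.
Proof. by apply: eq_bigr => i _; rewrite mulrAC. Qed.

Lemma pairingB (c : R) f g h :
  pairing (fun i => f i - c * g i) h = pairing f h - c * pairing g h.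
Proof.
rewrite /pairing big_distrr -sumrB.
by apply: eq_bigr => i _; rewrite /=; ring.
Qed.

(** Both sides sum $x_i x_j f(j) g(i)$ over the ordered pairs $i \ne j$. *)
Lemma pairing_transfer f g : pairing (transfer f) g = pairing f (transfer g).
Proof.
rewrite /pairing.
transitivity (\sum_i \sum_(j | j != i) (x i * x j * f j * g i)).
  apply: eq_bigr => i _; rewrite big_distrr big_distrl /=.
  by apply: eq_bigr => j _; ring.
rewrite (exchange_big_dep xpredT) //=; apply: eq_bigr => j _.
rewrite big_distrr; apply: eq_big => i; first by rewrite eq_sym.
by move=> _ /=; ring.
Qed.

Lemma pairing_iter_transfer f g m :
  pairing (iter m transfer f) g = pairing f (iter m transfer g).
Proof.
by elim: m f g => // m IH f g; rewrite iterS pairing_transfer IH -iterSr.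
Qed.

(** This is $X_{P_{m+1}}$ in the given variables: [m] counts edges, not vertices. *)
Definition path_moment m : R := pairing (fun=> 1) (iter m transfer (fun=> 1)).

(** With generating functions $E$ of the $e_k$, $E_i$ of the $e_k(\hat\imath)$, $H_i$ of the $(T^k
    1)(i)$ and $P$ of the path moments, one has $E = (1 + x_i t) E_i$ and $(1 + x_i t) H_i = 1 +
    tP$. Hence $E H_i = E_i (1 + tP)$, and the lemma compares the coefficients of $t^m$. *)
Lemma convolution_iter_transfer i m :
  \sum_(k < m.+1) elem_off set0 k * iter (m - k) transfer (fun=> 1) i =
  elem_off [set i] m +
  \sum_(k < m) elem_off [set i] k * path_moment (m - k.+1).
Proof.
set h := fun m => iter m transfer (fun=> 1) i.
rewrite (eq_bigr (fun k : 'I__ => elem_off set0 k * h (m - k)%N)) //.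
have hS k : h k.+1 + x i * h k = path_moment k.
  rewrite /h /= transferE; apply: eq_bigr => j _.
  by rewrite mulr1.
have e_S k : elem_off set0 k.+1 =
    elem_off [set i] k.+1 + x i * elem_off [set i] k.
  by rewrite (@elem_off_setU1 _ i) ?inE // setU0.
rewrite big_ord_recl /= subn0 elem_off0 -(elem_off0 [set i]).
rewrite (eq_bigr (fun k : 'I_m => elem_off [set i] k.+1 * h (m - k.+1)%N
   + x i * elem_off [set i] k * h (m - k.+1)%N)); last first.
  by move=> k _; rewrite e_S mulrDl.
rewrite big_split /= addrA.
have -> : elem_off [set i] 0 * h m +
   \sum_(k < m) elem_off [set i] k.+1 * h (m - k.+1)%N =
   \sum_(k < m.+1) elem_off [set i] k * h (m - k)%N.
  by rewrite big_ord_recl subn0.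
(* The term k = m is $e_m(\hat\imath)$, since $T^0 1 = 1$; the others pair up through [hS]. *)
rewrite big_ord_recr /= subnn {2}/h /= mulr1 addrAC -big_split /= addrC.
congr (_ + _); apply: eq_bigr => k _.
by rewrite -hS -subSn // subSS /=; ring.
Qed.

(** Multiply the convolution identity by $x_i$ and sum over i; [sum_mul_elem_off] then eliminates
    every $e_k(\hat\imath)$. *)
Lemma path_moment_rec m :
  path_moment m = m.+1%:R * elem_off set0 m.+1 +
    \sum_(k < m) k%:R * elem_off set0 k.+1 * path_moment (m - k.+1).
Proof.
have E : \sum_(k < m.+1) elem_off set0 k * path_moment (m - k) =
    m.+1%:R * elem_off set0 m.+1 +
    \sum_(k < m) k.+1%:R * elem_off set0 k.+1 * path_moment (m - k.+1).
  transitivity (\sum_i x i * (elem_off [set i] m +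
    \sum_(k < m) elem_off [set i] k * path_moment (m - k.+1))).
    under [RHS]eq_bigr => i _ do rewrite -convolution_iter_transfer big_distrr.
    rewrite exchange_big; apply: eq_bigr => k _ /=.
    rewrite big_distrr; apply: eq_bigr => i _ /=; ring.
  under eq_bigr => i _ do rewrite mulrDr.
  have sumE k : \sum_i x i * elem_off [set i] k =
      k.+1%:R * elem_off set0 k.+1.
    rewrite -sum_mul_elem_off.
    by apply: eq_big => [i|i _]; rewrite ?inE // setU0.
  rewrite big_split /= sumE; congr (_ + _).
  under eq_bigr => i _ do rewrite big_distrr.
  rewrite exchange_big /=.
  apply: eq_bigr => k _; rewrite -sumE big_distrl.
  by apply: eq_bigr => i _; rewrite /= mulrA.
(* The term k = 0 on the left is [path_moment m] itself. Moving the remaining terms to the right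
   lowers each coefficient from k+1 to k. *)
rewrite big_ord_recl subn0 elem_off0 mul1r in E.
rewrite -[LHS](addrK (\sum_(k < m) elem_off set0 (lift ord0 k) *
  path_moment (m - lift ord0 k))) E -addrA -sumrB; congr (_ + _).
by apply: eq_bigr => k _; rewrite lift0 -natr1; ring.
Qed.

(* The key identity $e_2(\hat\imath) = T^2 1 - e_2$:
   since $e_1(\hat\jmath) = e_1(\hat\imath,\hat\jmath) + x_i$, one has
   $T^2 1 = 2 e_2(\hat\imath) + x_i e_1(\hat\imath)$ at i. *)
Lemma elem_off2E i :
  elem_off [set i] 2 =
  iter 2 transfer (fun=> 1) i - elem_off set0 2 * iter 0 transfer (fun=> 1) i.
Proof.
have T1 j : transfer (fun=> 1) j = elem_off [set j] 1.
  rewrite -sum_elem_off0; apply: eq_big => k; first by rewrite inE.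
  by rewrite mulr1.
have -> : iter 2 transfer (fun=> 1) i =
    2%:R * elem_off [set i] 2 + x i * elem_off [set i] 1.
  rewrite -sum_mul_elem_off -sum_elem_off0 big_distrr /= -big_split /=.
  rewrite /transfer; apply: eq_big => [j|j ij]; first by rewrite inE.
  rewrite -/(transfer _ j) T1 (@elem_off_setU1 [set j] i) ?inE 1?eq_sym //.
  by rewrite elem_off0 setUC; ring.
rewrite (@elem_off_setU1 set0 i) ?inE // setU0 /=; ring.
Qed.

(** Expand $T^2 1 - e_2 1$ in both arguments. By self-adjointness, $T^a 1$ paired with $T^b 1$ is
    the path moment of index a + b. *)
Lemma pairing_elem_off2 m :
  pairing (fun i => elem_off [set i] 2)
          (iter m transfer (fun i => elem_off [set i] 2)) =
  path_moment m.+4 - 2%:R * elem_off set0 2 * path_moment m.+2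
    + elem_off set0 2 ^+ 2 * path_moment m.
Proof.
have iter_eq f g k : f =1 g -> iter k transfer f =1 iter k transfer g.
  by move=> fg; elim: k => //= k IH; apply: eq_transfer.
have pairE a b : pairing (iter a transfer (fun=> 1))
    (iter b transfer (fun=> 1)) = path_moment (a + b).
  by rewrite pairing_iter_transfer -iterD.
transitivity (pairing
  (fun i => iter 2 transfer (fun=> 1) i -
            elem_off set0 2 * iter 0 transfer (fun=> 1) i)
  (fun i => iter (m + 2) transfer (fun=> 1) i -
            elem_off set0 2 * iter m transfer (fun=> 1) i)).
  apply: eq_bigr => i _; rewrite -elem_off2E; congr (_ * _).
  rewrite (iter_eq _ _ _ elem_off2E) iter_transferB -iterD; ring.
rewrite pairingB !(pairing_sym _ (fun i => _ - _)) !pairingB.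
rewrite !(pairing_sym (iter (m + 2) _ _)) !(pairing_sym (iter m _ _)) !pairE.
rewrite !add0n !addnA addnC !add2n addn2; ring.
Qed.

End ElementaryOff.

(** * Colorings of a path as words whose neighboring letters differ *)

Section Words.
Variables (R : comNzRingType) (I : finType) (x : I -> R).
Implicit Types (F : seq I -> R) (g : I -> R) (w : seq I).

(** Summing over words, instead of over functions on the vertices, allows letters to be split off at
    either end. *)
Fixpoint word_sum n F : R :=
  if n is n'.+1 then \sum_i word_sum n' (fun w => F (i :: w)) else F [::].

Lemma eq_word_sum n F1 F2 :
  (forall w, size w = n -> F1 w = F2 w) -> word_sum n F1 = word_sum n F2.
Proof.
elim: n F1 F2 => [|n IH] F1 F2 F12 /=; first exact: F12.
by apply: eq_bigr => i _; apply: IH => w sw; apply: F12; rewrite /= sw.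
Qed.

Lemma word_sum_sum n (J : finType) (F : J -> seq I -> R) :
  \sum_j word_sum n (F j) = word_sum n (fun w => \sum_j F j w).
Proof.
elim: n F => [|n IH] F //=; rewrite exchange_big /=.
by apply: eq_bigr => i _; rewrite IH.
Qed.

Lemma word_sumZ n c F : word_sum n (fun w => c * F w) = c * word_sum n F.
Proof.
elim: n F => [|n IH] F //=; rewrite big_distrr /=.
by apply: eq_bigr => i _; rewrite IH.
Qed.

Lemma word_sum_rcons n F :
  word_sum n.+1 F = word_sum n (fun w => \sum_i F (rcons w i)).
Proof.
elim: n F => [|n IH] F //.
by apply: eq_bigr => i _; exact: (IH (fun w => F (i :: w))).
Qed.

Lemma sum_ffun_word_sum n F :
  \sum_(k : {ffun 'I_n -> I}) F (map k (enum 'I_n)) = word_sum n F.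
Proof.
elim: n F => [|n IH] F /=.
  rewrite (eq_bigr (fun=> F [::])) => [|k _]; last first.
    by rewrite (size0nil (s := enum 'I_0)) // size_enum_ord.
  by rewrite sumr_const card_ffun card_ord expn0.
pose cons (p : I * {ffun 'I_n -> I}) : {ffun 'I_n.+1 -> I} :=
  [ffun i => oapp p.2 p.1 (unlift ord0 i)].
pose uncons (k : {ffun 'I_n.+1 -> I}) : I * {ffun 'I_n -> I} :=
  (k ord0, [ffun i => k (lift ord0 i)]).
rewrite (reindex cons) /=; last first.
  exists uncons => [[i k] _|k _].
    rewrite /uncons /cons ffunE unlift_none /=; congr (_, _).
    by apply/ffunP => j; rewrite !ffunE liftK.
  apply/ffunP => j; rewrite ffunE.
  by case: unliftP => [j' ->|->] //=; rewrite ffunE.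
rewrite -(pair_bigA _ (fun i k => F (map (cons (i, k)) (enum 'I_n.+1)))) /=.
apply: eq_bigr => i _; rewrite -IH; apply: eq_bigr => k _.
rewrite enum_ordSl /= ffunE unlift_none -map_comp; congr (F (_ :: _)).
by apply: eq_map => j; rewrite /= ffunE liftK.
Qed.

Definition neq_rel : rel I := fun a b => a != b.

(** Each application of [transfer] sums over one further letter, required to differ from the one
    before it. *)
Lemma word_sum_path n i g :
  word_sum n (fun w =>
    if path neq_rel i w then \prod_(j <- w) x j * g (last i w) else 0) =
  iter n (transfer x) g i.
Proof.
elim: n i => [|n IH] i /=; first by rewrite big_nil mul1r.
rewrite /transfer [RHS]big_mkcond; apply: eq_bigr => j _.
rewrite /neq_rel eq_sym; case: eqP => _ /=.
  by rewrite (@eq_word_sum n _ (fun=> 0 * 0)) ?word_sumZ ?mul0r.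
rewrite -IH -word_sumZ; apply: eq_word_sum => w _.
by case: ifP; rewrite ?mulr0 // big_cons mulrA.
Qed.

Lemma word_sum_sorted n :
  word_sum n.+1 (fun w => if sorted neq_rel w then \prod_(j <- w) x j else 0) =
  path_moment x n.
Proof.
apply: eq_bigr => i _; rewrite mulr1 -word_sum_path -word_sumZ.
apply: eq_word_sum => w _ /=.
by case: ifP; rewrite ?mulr0 // big_cons mulr1.
Qed.

(* The sum of the colors available to a twin of the first letter of w. *)
Definition twin_weight w : R :=
  if w is a :: b :: _ then elem_off x [set b; a] 1 else 0.

(** A leaf and its twin receive an ordered pair of distinct colors other than [b], whence the factor
    2. *)
Lemma sum_twin_weight b :
  \sum_(a | a != b) x a * elem_off x [set b; a] 1 =
  2%:R * elem_off x [set b] 2.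
Proof.
rewrite -sum_mul_elem_off; apply: eq_big => a; first by rewrite inE.
by rewrite setUC.
Qed.

(** Split off the first letter a and the last letter c. Each of the two sums is $2 e_2$ in the
    colors other than that of the neighboring letter, and the word in between contributes n
    applications of [transfer]. For n = 0 both leaves have the same neighbor. *)
Lemma word_sum_twinned n :
  word_sum n.+3 (fun w => if sorted neq_rel w then
    \prod_(j <- w) x j * twin_weight w * twin_weight (rev w) else 0) =
  4%:R * pairing x (fun i => elem_off x [set i] 2)
           (iter n (transfer x) (fun i => elem_off x [set i] 2)).
Proof.
set F := (X in word_sum _ X).
transitivity (\sum_a word_sum n.+1 (fun w => \sum_c F (a :: rcons w c))).
  apply: eq_bigr => a _; exact: (word_sum_rcons n.+1 (fun w => F (a :: w))).
rewrite word_sum_sum /pairing big_distrr; apply: eq_bigr => b _ /=.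
rewrite -word_sum_path -!word_sumZ; apply: eq_word_sum => w _.
transitivity (\sum_(a | a != b) \sum_(c | c != last b w)
  if path neq_rel b w then (x a * elem_off x [set b; a] 1) *
    (x b * \prod_(j <- w) x j * (x c * elem_off x [set last b w; c] 1)) else 0).
  rewrite [RHS]big_mkcond; apply: eq_bigr => a _; rewrite /F /=.
  rewrite /neq_rel; case: (a != b) => /=; last by rewrite big1.
  rewrite [RHS]big_mkcond; apply: eq_bigr => c _.
  rewrite rcons_path [c == _]eq_sym.
  case: ifP => [/andP[-> ->]|].
    have -> : rev [:: a, b & rcons w c] =
        [:: c, last b w & rev (a :: belast b w)].
      rewrite -[LHS]/(rev (rcons [:: a, b & w] c)) rev_rcons.
      by rewrite [in LHS](lastI a) rev_rcons.
    by rewrite !big_cons -cats1 big_cat big_seq1 /=; ring.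
  by case: path => /= E; [rewrite E | case: ifP].
case: (path _ b w); last by rewrite big1 ?mulr0 // => a _; rewrite big1.
transitivity ((\sum_(a | a != b) x a * elem_off x [set b; a] 1) *
  (\sum_(c | c != last b w)
     x b * \prod_(j <- w) x j * (x c * elem_off x [set last b w; c] 1))).
  by rewrite big_distrlr.
rewrite -big_distrr /= !sum_twin_weight; ring.
Qed.

End Words.

(** * Chromatic polynomials of paths and twinned paths *)

Section Colorings.
Variable N : nat.

Lemma big_option (R : Type) (idx : R) (op : Monoid.com_law idx) (T : finType)
    (F : option T -> R) :
  \big[op/idx]_o F o = op (F None) (\big[op/idx]_t F (Some t)).
Proof.
rewrite (bigD1 None) //=; congr (op _ _).
rewrite (reindex_omap Some id) => [|[t|] //].
by apply: eq_bigl => t; rewrite /= eqxx.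
Qed.

Lemma proper_twin (G : sgraph) (v : G) (T : eqType) (k : twin v -> T) :
  proper_coloring k = proper_coloring (fun u : G => k (Some u)) &&
    [forall u, ((u == v) || adj v u) ==> (k (Some u) != k None)].
Proof.
apply/forallP/andP => [pk|[/forallP pk /forallP kv] [u|]].
- split; apply/forallP => u; last first.
    by have /forallP/(_ None) := pk (Some u).
  by apply/forallP => w; have /forallP/(_ (Some w)) := pk (Some u).
- apply/forallP => -[w|]; last exact: kv.
  by have /forallP/(_ w) := pk u.
- apply/forallP => -[w|] //=; rewrite [k None == _]eq_sym; exact: kv.
Qed.

Definition extend_coloring (T : finType) (k : {ffun T -> 'I_N}) c :
  {ffun option T -> 'I_N} := [ffun o => oapp k c o].

Lemma sum_twin (R : nmodType) (G : sgraph) (v : G)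
    (F : {ffun twin v -> 'I_N} -> R) :
  \sum_(k : {ffun twin v -> 'I_N} | proper_coloring k) F k =
  \sum_(k : {ffun G -> 'I_N} | proper_coloring k)
    \sum_(c | [forall u, ((u == v) || adj v u) ==> (k u != c)])
      F (extend_coloring k c).
Proof.
rewrite pair_big_dep /=.
rewrite (reindex (fun p : {ffun G -> 'I_N} * 'I_N =>
  extend_coloring p.1 p.2)) /=; last first.
  exists (fun k : {ffun twin v -> 'I_N} => ([ffun u => k (Some u)], k None)).
    move=> [k c] _ /=; congr pair; last by rewrite ffunE.
    by apply/ffunP => u; rewrite !ffunE.
  move=> k _; apply/ffunP => o; rewrite ffunE.
  by case: o => [u|] //=; rewrite ffunE.
apply: eq_bigl => -[k c] /=; rewrite proper_twin.
congr (_ && _).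
  by apply: (proper_coloring_inj (f := id)) => // u; rewrite ffunE.
by apply: eq_forallb => u; rewrite !ffunE.
Qed.

Lemma proper_path n (k : {ffun 'I_n -> 'I_N}) :
  proper_coloring (G := path_graph n) k =
  sorted (@neq_rel _) (map k (enum 'I_n)).
Proof.
case: n k => [|n] k.
  have -> : enum 'I_0 = [::] by apply: size0nil; rewrite size_enum_ord.
  by apply/forallP => -[].
have sz : size (map k (enum 'I_n.+1)) = n.+1.
  by rewrite size_map size_enum_ord.
have nthE i : (i < n.+1)%N ->
    nth (k ord0) (map k (enum 'I_n.+1)) i = k (inord i).
  move=> lt_i; rewrite (nth_map ord0) ?size_enum_ord //; congr (k _).
  by apply: val_inj; rewrite /= nth_enum_ord // inordK.
apply/forallP/(sortedP (k ord0)) => [pk i|sk u].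
  rewrite sz => lt_i; rewrite !nthE // 1?ltnW // /neq_rel.
  have /forallP/(_ (inord i.+1)) := pk (inord i).
  by rewrite /= /path_adj !inordK ?eqxx // ltnW.
apply/forallP => w; apply/implyP => /orP[] /eqP E.
  have := sk u; rewrite sz E ltn_ord => /(_ isT).
  by rewrite !nthE ?ltn_ord // !inord_val.
have := sk w; rewrite sz E ltn_ord => /(_ isT).
by rewrite !nthE ?ltn_ord // !inord_val eq_sym.
Qed.

Let x (i : 'I_N) : {mpoly rat[N]} := 'X_i.

Lemma elem_off_set0 k : elem_off x set0 k = mesym N rat k.
Proof. by apply: eq_bigl => B; rewrite -setI_eq0 setI0 eqxx. Qed.

Lemma prod_coloring n (k : {ffun 'I_n -> 'I_N}) :
  \prod_(j <- map k (enum 'I_n)) x j = \prod_u x (k u).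
Proof. by rewrite big_map big_enum. Qed.

Lemma prod_extend_coloring (T : finType) (k : {ffun T -> 'I_N}) c :
  \prod_o x (extend_coloring k c o) = x c * \prod_u x (k u).
Proof.
rewrite big_option ffunE; congr (_ * _).
by apply: eq_bigr => u _; rewrite ffunE.
Qed.

Lemma chromatic_poly_path n :
  chromatic_poly (path_graph n.+1) N = path_moment x n.
Proof.
rewrite -word_sum_sorted -sum_ffun_word_sum /chromatic_poly big_mkcond.
by apply: eq_bigr => k _; rewrite proper_path prod_coloring.
Qed.

(** With at least three path vertices the two twins are not adjacent, so their colors are chosen
    independently and contribute the product of the two twin weights. *)
Lemma chromatic_poly_twinned_path n :
  chromatic_poly (twinned_path n.+3) N =
  4%:R * (path_moment x n.+4 - 2%:R * mesym N rat 2 * path_moment x n.+2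
    + mesym N rat 2 ^+ 2 * path_moment x n).
Proof.
rewrite -elem_off_set0 -pairing_elem_off2 -word_sum_twinned.
rewrite -sum_ffun_word_sum /chromatic_poly !sum_twin big_mkcond.
apply: eq_bigr => k _; rewrite proper_path; case: ifP => // _.
rewrite prod_coloring -mulrA.
(* The twin of vertex 0 avoids exactly the colors of vertices 0 and 1; the other end is treated by
   reversing the word. *)
have -> : twin_weight x (map k (enum 'I_n.+3)) =
    \sum_(c | [forall u, ((u == ord0) || path_adj ord0 u) ==> (k u != c)]) x c.
  rewrite !enum_ordSl /= -sum_elem_off0; apply: eq_bigl => c.
  rewrite !inE negb_or ![c == _]eq_sym.
  apply/andP/forallP => [[c1 c0] u|kc].
    apply/implyP => /orP[/eqP -> //|/orP[/eqP E|//]].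
    by rewrite (_ : u = lift ord0 ord0) //; apply: val_inj.
  by split; [have := kc (lift ord0 ord0) | have := kc ord0].
have -> : twin_weight x (rev (map k (enum 'I_n.+3))) = \sum_(c |
    [forall u, ((u == ord_max) || path_adj ord_max u) ==> (k u != c)]) x c.
  rewrite !enum_ordSr !map_rcons !rev_rcons /= -sum_elem_off0.
  apply: eq_bigl => c; rewrite !inE negb_or ![c == _]eq_sym.
  set p := widen_ord _ _.
  apply/andP/forallP => [[c1 c0] u|kc].
    apply/implyP => /orP[/eqP -> //|/orP[|]] /eqP E.
      by have := ltn_ord u; rewrite -E ltnn.
    rewrite (_ : u = p) //; apply: val_inj => /=.
    by case: E.
  split; [have := kc p | have := kc ord_max]; rewrite ?eqxx //.
  by rewrite /path_adj /= eqxx !orbT.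
rewrite big_distrlr big_distrr; apply: eq_bigr => c _ /=.
rewrite big_distrr; apply: eq_big => c' /=.
  (* The case closed by [//] is the first twin, which is not adjacent to the second leaf. *)
  apply/forallP/forallP => [kc u|kc [u|//]].
    by have := kc (Some u); rewrite ffunE.
  by rewrite ffunE; exact: kc.
by move=> _; rewrite !prod_extend_coloring; ring.
Qed.

(** Here the twins are adjacent and the graph is $K_4$. Its four colors are summed out in turn,
    which gives $24 = 2 \cdot 3 \cdot 4$. *)
Lemma chromatic_poly_twinned_path2 :
  chromatic_poly (twinned_path 2) N = 24%:R * mesym N rat 4.
Proof.
(* [a] and [b] color the path; the last factor sums over the ordered pairs of distinct colors left
   for the two twins. *)
pose F w := if w is [:: a; b] then
  if a != b then x a * x b * (2%:R * elem_off x [set b; a] 2) else 0 else 0.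
transitivity (word_sum 2 F); last first.
  transitivity (2%:R * \sum_a x a * \sum_(b | b \notin [set a])
    x b * elem_off x (b |: [set a]) 2).
    rewrite big_distrr; apply: eq_bigr => a _ /=.
    rewrite !big_distrr [RHS]big_mkcond; apply: eq_bigr => b _ /=.
    by rewrite inE eq_sym; case: eqP => //= _; ring.
  under eq_bigr => a _ do rewrite sum_mul_elem_off mulrCA.
  rewrite -big_distrr /=.
  have -> : \sum_a x a * elem_off x [set a] 3 = 4%:R * elem_off x set0 4.
    rewrite -sum_mul_elem_off.
    by apply: eq_big => [a|a _]; rewrite ?inE // setU0.
  by rewrite elem_off_set0; ring.
rewrite -sum_ffun_word_sum /chromatic_poly !sum_twin big_mkcond.
apply: eq_bigr => k _; rewrite proper_path !enum_ordSl.
have -> : enum 'I_0 = [::] by apply: size0nil; rewrite size_enum_ord.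
rewrite /= andbT /neq_rel; set k1 := k (lift _ _); case: ifP => // k01.
have ord2 (u : 'I_2) : u = ord0 \/ u = lift ord0 ord0.
  by case: u => -[|[|//]] lt_u; [left | right]; apply: val_inj.
rewrite -sum_mul_elem_off big_distrr /=; apply: eq_big => c /=.
  rewrite !inE negb_or ![c == _]eq_sym; apply/forallP/andP => [kc|[kc1 kc0] u].
    by split; [have := kc (lift ord0 ord0) | have := kc ord0].
  by apply/implyP => _; case: (ord2 u) => ->.
move=> _; rewrite -sum_elem_off0 !big_distrr /=; apply: eq_big => c' /=.
  rewrite !inE !negb_or ![c' == _]eq_sym.
  apply/forallP/and3P => [kc|[kc kc1 kc0] [u|]].
  - split.
    + by have := kc None; rewrite ffunE.
    + by have := kc (Some (lift ord0 ord0)); rewrite ffunE.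
    + by have := kc (Some ord0); rewrite ffunE.
  - by apply/implyP => _; rewrite ffunE; case: (ord2 u) => ->.
  - by apply/implyP => _; rewrite ffunE.
move=> _; rewrite !prod_extend_coloring !big_ord_recl big_ord0 -/k1; ring.
Qed.

End Colorings.

(** * From finitely many variables to symmetric functions *)

Lemma sfprojD N f g : sfproj (f + g) N = sfproj f N + sfproj g N.
Proof. by []. Qed.

Lemma sfprojM N f g : sfproj (f * g) N = sfproj f N * sfproj g N.
Proof. by []. Qed.

Lemma sfprojN N f : sfproj (- f) N = - sfproj f N.
Proof. by rewrite /= scaleN1r. Qed.

Lemma sfproj_sum N (I : Type) (r : seq I) (P : pred I) (F : I -> symfun) :
  sfproj (\sum_(i <- r | P i) F i) N = \sum_(i <- r | P i) sfproj (F i) N.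
Proof. by apply: (big_morph (fun f => sfproj f N)) => //=; rewrite mpolyC0. Qed.

Lemma sfproj_nat N n : sfproj n%:R N = n%:R.
Proof.
elim: n => [|n IH]; first by rewrite /= mpolyC0.
by rewrite !mulrS -IH /= mpolyC1.
Qed.

Lemma chromatic_sf_path_rec n :
  chromatic_sf (path_graph n.+1) = n.+1%:R * \e_n.+1 +
  \sum_(2 <= j < n.+1) (j - 1)%:R * \e_j * chromatic_sf (path_graph (n.+1 - j)).
Proof.
apply: symfunP => N; rewrite [LHS]/= chromatic_poly_path path_moment_rec.
rewrite [RHS]/= sfproj_sum sfproj_nat elem_off_set0; congr (_ + _).
case: n => [|n]; first by rewrite big_ord0 big_geq.
(* The term k = 0 has coefficient 0; the remaining ones are reindexed by j = k + 1, so that j starts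
   at 2. *)
rewrite big_ord_recl mul0r mul0r add0r (big_addn 0 n.+2 2) subSS subSS subn0.
rewrite big_mkord; apply: eq_bigr => k _.
rewrite [RHS]/= sfproj_nat elem_off_set0 lift0 addn2 subn1 !subSS.
by rewrite -(subnSK (ltn_ord k)) chromatic_poly_path.
Qed.

(** A quarter of $X_{P_{n,v,w}}$ for $n \ge 3$, written through paths so that their recurrence
    applies. *)
Definition twinned_quarter n : symfun :=
  chromatic_sf (path_graph n.+2) - 2%:R * \e_2 * chromatic_sf (path_graph n)
  + \e_2 ^+ 2 * chromatic_sf (path_graph (n - 2)).

Lemma chromatic_sf_twinned_path n : (3 <= n)%N ->
  \XP_n = 4%:R * twinned_quarter n.
Proof.
case: n => [|[|[|n]]] // _; apply: symfunP => N.
rewrite [LHS]/= chromatic_poly_twinned_path.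
rewrite /twinned_quarter expr2 sfprojM sfproj_nat.
rewrite !sfprojD sfprojN !sfprojM sfproj_nat.
rewrite !subSS subn0.
have pE k : sfproj (chromatic_sf (path_graph k.+1)) N = _ :=
  chromatic_poly_path N k.
by rewrite !pE.
Qed.

Lemma chromatic_sf_twinned_path2 : \XP_2 = 24%:R * \e_4.
Proof.
apply: symfunP => N; rewrite sfprojM sfproj_nat /=.
exact: chromatic_poly_twinned_path2.
Qed.

Lemma scale_quarter (f : symfun) : 4%:R^-1 *: (4%:R * f) = f.
Proof. by rewrite mulr_natl -scaler_nat scalerA mulVf ?scale1r. Qed.

(** * Small cases *)

Lemma chromatic_sf_path1 : chromatic_sf (path_graph 1) = \e_1.
Proof. by rewrite chromatic_sf_path_rec big_geq // addr0 mul1r. Qed.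

Lemma chromatic_sf_path2 : chromatic_sf (path_graph 2) = 2%:R * \e_2.
Proof. by rewrite chromatic_sf_path_rec big_geq // addr0. Qed.

Lemma chromatic_sf_path3 :
  chromatic_sf (path_graph 3) = 3%:R * \e_3 + \e_2 * \e_1.
Proof.
by rewrite chromatic_sf_path_rec unlock /= /subn /= chromatic_sf_path1; ring.
Qed.

Lemma chromatic_sf_path4 : chromatic_sf (path_graph 4) =
  4%:R * \e_4 + 2%:R * \e_2 ^+ 2 + 2%:R * \e_3 * \e_1.
Proof.
rewrite chromatic_sf_path_rec unlock /= /subn /=.
rewrite chromatic_sf_path1 chromatic_sf_path2.
ring.
Qed.

Lemma chromatic_sf_path5 : chromatic_sf (path_graph 5) =
  5%:R * \e_5 + 3%:R * \e_4 * \e_1 + 7%:R * \e_3 * \e_2 + \e_2 ^+ 2 * \e_1.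
Proof.
rewrite chromatic_sf_path_rec unlock /= /subn /=.
rewrite chromatic_sf_path1 chromatic_sf_path2.
rewrite chromatic_sf_path3; ring.
Qed.

Lemma twinned_quarter3 :
  twinned_quarter 3 = 5%:R * \e_5 + 3%:R * \e_4 * \e_1 + \e_3 * \e_2.
Proof.
rewrite /twinned_quarter /subn /= chromatic_sf_path5 chromatic_sf_path3.
rewrite chromatic_sf_path1; ring.
Qed.

Lemma twinned_quarter4 : twinned_quarter 4 =
  6%:R * \e_6 + 4%:R * \e_5 * \e_1 + 2%:R * \e_4 * \e_2 + 6%:R * \e_3 ^+ 2.
Proof.
rewrite /twinned_quarter chromatic_sf_path_rec unlock /= /subn /=.
rewrite chromatic_sf_path4 chromatic_sf_path3 chromatic_sf_path2.
rewrite chromatic_sf_path1; ring.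
Qed.

Lemma twinned_quarter5 : twinned_quarter 5 =
  7%:R * \e_7 + 5%:R * \e_6 * \e_1 + 3%:R * \e_5 * \e_2
  + 17%:R * \e_4 * \e_3 + 4%:R * \e_3 * \e_3 * \e_1.
Proof.
rewrite /twinned_quarter chromatic_sf_path_rec unlock /= /subn /=.
rewrite chromatic_sf_path5 chromatic_sf_path4 chromatic_sf_path3.
rewrite chromatic_sf_path2 chromatic_sf_path1; ring.
Qed.

(** Apply the path recurrence to $P_{n+2}$, $P_n$ and $P_{n-2}$. The terms with $j \le n-3$ occur in
    all three and recombine into twinned paths; the last four terms for $P_{n+2}$ and the last two
    for $P_n$ involve only paths on at most four vertices and give the explicit terms. *)
Lemma twinned_quarter_rec n : (6 <= n)%N ->
  twinned_quarter n =
  \sum_(3 <= j < n - 2) (j - 1)%:R * \e_j * twinned_quarter (n - j)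
  + (n + 2)%:R * \e_(n + 2)
  + n%:R * \e_(n + 1) * \e_1
  + (3 * (n - 2))%:R * \e_(n - 1) * \e_3
  + (2 * (n - 3))%:R * \e_(n - 2) * \e_3 * \e_1
  + (4 * (n - 3))%:R * \e_(n - 2) * \e_4
  + \e_2 * (twinned_quarter (n - 2)
            - 2%:R * \e_n
            - (n - 4)%:R * \e_(n - 2) * \e_2
            - (n - 2)%:R * \e_(n - 1) * \e_1).
Proof.
move=> n_ge6; have [m ->] : exists m, n = m.+4.+2.
  by exists (n - 6)%N; rewrite -[_.+4.+2]/(6 + _)%N subnKC.
rewrite {n n_ge6} addn2 addn1 !subSS !subn0.
pose p n := chromatic_sf (path_graph n).
have S : \sum_(2 <= j < m.+4) (j - 1)%:R * \e_j *
      twinned_quarter (m.+4.+2 - j) =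
    \sum_(2 <= j < m.+4) (j - 1)%:R * \e_j * p (m.+4.+4 - j)%N
    - 2%:R * \e_2 * \sum_(2 <= j < m.+4) (j - 1)%:R * \e_j * p (m.+4.+2 - j)%N
    + \e_2 ^+ 2 * \sum_(2 <= j < m.+4) (j - 1)%:R * \e_j * p (m.+4 - j)%N.
  rewrite !big_distrr -sumrB -big_split /=.
  apply: eq_big_nat => j /andP[_ lt_j].
  have le_j : (j <= m.+4)%N by exact: ltnW.
  rewrite /twinned_quarter subnAC !subSS subn0.
  rewrite (subSn (leqW (leqW (leqW le_j)))) (subSn (leqW (leqW le_j))) /p.
  ring.
have diff a : (a + m - m)%N = a by rewrite addnK.
have P8 : p m.+4.+4 = m.+4.+4%:R * \e_m.+4.+4 +
    (\sum_(2 <= j < m.+4) (j - 1)%:R * \e_j * p (m.+4.+4 - j)%N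
     + m.+3%:R * \e_m.+4 * p 4 + m.+4%:R * \e_m.+4.+1 * p 3
     + m.+4.+1%:R * \e_m.+4.+2 * p 2 + m.+4.+2%:R * \e_m.+4.+3 * p 1).
  rewrite /p chromatic_sf_path_rec; congr (_ + _).
  rewrite 4?big_nat_recr //= !subSS !subn0.
  by rewrite (diff 4) (diff 3) (diff 2) (diff 1).
have P6 : p m.+4.+2 = m.+4.+2%:R * \e_m.+4.+2 +
    (\sum_(2 <= j < m.+4) (j - 1)%:R * \e_j * p (m.+4.+2 - j)%N
     + m.+3%:R * \e_m.+4 * p 2 + m.+4%:R * \e_m.+4.+1 * p 1).
  rewrite /p chromatic_sf_path_rec; congr (_ + _).
  rewrite 2?big_nat_recr //= !subSS !subn0.
  by rewrite (diff 2) (diff 1).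
have P4 : p m.+4 = m.+4%:R * \e_m.+4 +
    \sum_(2 <= j < m.+4) (j - 1)%:R * \e_j * p (m.+4 - j)%N.
  by rewrite /p chromatic_sf_path_rec.
have -> : twinned_quarter m.+4.+2 = p m.+4.+4
    - 2%:R * \e_2 * p m.+4.+2 + \e_2 ^+ 2 * p m.+4.
  by rewrite /twinned_quarter !subSS subn0.
rewrite P8 P6 P4.
(* The summand j = 2 of [S] supplies the $e_2 \cdot \frac14 X_{P_{n-2,v,w}}$ of the bracket. *)
move: S; rewrite (@big_ltn _ _ _ 2 m.+4 (fun j => _ * twinned_quarter _)) //.
rewrite !subSS !subn0 mul1r.
set s8 := \sum_(2 <= j < _) _ * p (m.+4.+4 - j)%N.
set s6 := \sum_(2 <= j < _) _ * p (m.+4.+2 - j)%N.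
set s4 := \sum_(2 <= j < _) _ * p (m.+4 - j)%N.
set s := \sum_(3 <= j < _) _.
move=> /(canRL (addKr _)) ->.
rewrite /p chromatic_sf_path1 chromatic_sf_path2 chromatic_sf_path3.
rewrite chromatic_sf_path4; ring.
Qed.

(** * Closure properties of e-positivity, and the positivity of twinned paths *)

Lemma e_positive0 : e_positive 0.
Proof. by exists [::], (fun=> 0); split=> //; rewrite big_nil. Qed.

(** The list of partitions must stay free of duplicates: if [la] already occurs, its coefficient
    grows by [c]; otherwise [la] is prepended. *)
Lemma e_positive_addZ (c : rat) la f : 0 <= c -> is_partition la ->
  e_positive f -> e_positive (c *: sf_elem_part la + f).
Proof.
move=> c_ge0 la_part [s [d [s_uniq s_part d_ge0 ->]]].
(* The sign of [d] is unknown outside [s], so [d] is replaced by 0 there. *)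
pose d' mu := (if mu == la then c else 0) + (if mu \in s then d mu else 0).
exists (if la \in s then s else la :: s), d'.
have d'E : {in s, forall mu, d' mu = (if mu == la then c else 0) + d mu}.
  by move=> mu mu_s; rewrite /d' mu_s.
have sumE : \sum_(mu <- s | mu != la) d' mu *: sf_elem_part mu =
            \sum_(mu <- s | mu != la) d mu *: sf_elem_part mu.
  rewrite big_seq_cond [RHS]big_seq_cond; apply: eq_bigr => mu /andP[mu_s].
  by move=> /negPf mu_la; rewrite d'E // mu_la add0r.
split.
- by case: ifP => //= ->.
- by case: ifP => //= _; rewrite la_part.
- move=> mu _; rewrite /d' addr_ge0 //; first by case: ifP.
  by case: ifP => // /d_ge0.
case: ifP => la_s.
  rewrite (bigD1_seq la) // [RHS](bigD1_seq la) //= sumE d'E // eqxx.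
  by rewrite scalerDl addrA.
rewrite big_cons /d' eqxx la_s addr0; congr (_ + _).
rewrite big_seq [RHS]big_seq; apply: eq_bigr => mu mu_s.
rewrite mu_s (_ : mu == la = false) ?add0r //.
by apply: contraFF la_s => /eqP <-.
Qed.

Lemma e_positiveD f g : e_positive f -> e_positive g -> e_positive (f + g).
Proof.
move=> [s [c [_ s_part c_ge0 ->]]] g_pos; elim: s s_part c_ge0 => [|la s IH] /=.
  by rewrite big_nil add0r.
move=> /andP[la_part s_part] c_ge0; rewrite big_cons -addrA.
apply: e_positive_addZ => //; first by rewrite c_ge0 ?mem_head.
by apply: IH => // mu mu_s; rewrite c_ge0 // inE mu_s orbT.
Qed.

Lemma e_positive_sum (I : eqType) (r : seq I) (F : I -> symfun) :
  {in r, forall i, e_positive (F i)} -> e_positive (\sum_(i <- r) F i).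
Proof.
move=> F_pos; rewrite big_seq.
by apply: big_ind => //; [exact: e_positive0 | exact: e_positiveD].
Qed.

Lemma e_positive_part (c : rat) la : 0 <= c -> 0%N \notin la ->
  e_positive (c *: sf_elem_part la).
Proof.
move=> c_ge0 la0; have sortP : perm_eq (sort geq la) la by rewrite perm_sort.
rewrite /sf_elem_part -(perm_big _ sortP) -/(sf_elem_part _).
rewrite -[X in e_positive X]addr0.
apply: e_positive_addZ e_positive0 => //.
rewrite /is_partition mem_sort la0 andbT; apply: sort_sorted.
by move=> m n; exact: leq_total.
Qed.

Lemma e_positive_elemM k f : e_positive f -> e_positive (\e_k.+1 * f).
Proof.
move=> [s [c [_ /allP s_part c_ge0 ->]]]; rewrite big_distrr /=.
apply: e_positive_sum => la la_s; rewrite -scalerAr.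
have -> : \e_k.+1 * sf_elem_part la = sf_elem_part (k.+1 :: la).
  by rewrite /sf_elem_part big_cons.
apply: e_positive_part; first exact: c_ge0.
by rewrite inE; case/andP: (s_part _ la_s).
Qed.

Lemma e_positive_natM n f : e_positive f -> e_positive (n%:R * f).
Proof.
move=> f_pos; elim: n => [|n IH]; first by rewrite mul0r; exact: e_positive0.
by rewrite -natr1 mulrDl mul1r; exact: e_positiveD.
Qed.

Lemma e_positive1 : e_positive 1.
Proof.
have -> : 1 = 1 *: sf_elem_part [::] by rewrite scale1r /sf_elem_part big_nil.
exact: e_positive_part.
Qed.

Lemma e_positive_elem k : e_positive \e_k.+1.
Proof. by rewrite -[\e_k.+1]mulr1; exact/e_positive_elemM/e_positive1. Qed.

(** The indices of the elementary functions must be visible successors; hence the case splits and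
    rewriting of indices before its calls. *)
Local Ltac epos := repeat first
  [ assumption | exact: e_positive_elem | apply: e_positive_natM
  | apply: e_positiveD | apply: e_positive_elemM | rewrite -!mulrA ].

(* The subtracted terms of the recurrence are exactly those terms of
   $\frac14 X_{P_{n-2,v,w}}$ that are singled out here. *)
Lemma twinned_quarter_e_positive n : (3 <= n)%N ->
  exists2 z, e_positive z &
    twinned_quarter n = (n + 2)%:R * \e_(n + 2) + n%:R * \e_(n + 1) * \e_1
      + (n - 2)%:R * \e_n * \e_2 + z.
Proof.
elim/ltn_ind: n => n IH n_ge3.
have [n_ge6|] := leqP 6 n; last first.
  case: n n_ge3 {IH} => [|[|[|[|[|[|//]]]]]] // _ _; rewrite /addn /subn /=.
  - by exists 0; [exact: e_positive0 | rewrite twinned_quarter3; ring].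
  - exists (6%:R * \e_3 * \e_3); last by rewrite twinned_quarter4; ring.
    epos.
  - exists (17%:R * \e_4 * \e_3 + 4%:R * \e_3 * \e_3 * \e_1).
      epos.
    by rewrite twinned_quarter5; ring.
have Y_pos k : (3 <= k)%N -> (k < n)%N -> e_positive (twinned_quarter k).
  move=> k_ge3 lt_kn; have [z z_pos ->] := IH k lt_kn k_ge3.
  by case: k k_ge3 {lt_kn} => // k _; rewrite addn1 addn2; epos.
have [|//|z z_pos Yz] := IH (n - 2)%N.
- by rewrite ltn_subrL (leq_trans _ n_ge3).
- by rewrite leq_subRL ?(leq_trans _ n_ge6) // (leq_trans _ n_ge6).
(* By the induction hypothesis at n - 2, the bracket of the recurrence is $(n-2) e_n + z$. Times
   $e_2$, its first term is the third one singled out for n, and $e_2 z$ joins the remainder. *)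
exists (\sum_(3 <= j < n - 2) (j - 1)%:R * \e_j * twinned_quarter (n - j)
  + (3 * (n - 2))%:R * \e_(n - 1) * \e_3
  + (2 * (n - 3))%:R * \e_(n - 2) * \e_3 * \e_1
  + (4 * (n - 3))%:R * \e_(n - 2) * \e_4 + \e_2 * z).
  have [m En] : exists m, n = m.+4.+2.
    by exists (n - 6)%N; rewrite -[_.+4.+2]/(6 + _)%N subnKC.
  have sum_pos : e_positive
     (\sum_(3 <= j < n - 2) (j - 1)%:R * \e_j * twinned_quarter (n - j)).
    apply: e_positive_sum => j; rewrite mem_index_iota => /andP[j_ge3 lt_j].
    have j_gt0 : (0 < j)%N by exact: leq_trans j_ge3.
    have Yj : e_positive (twinned_quarter (n - j)).
      apply: Y_pos; first by rewrite ltn_subRL addnC -ltn_subRL.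
      by rewrite ltn_subrL j_gt0 (leq_trans _ n_ge3).
    by case: j j_gt0 {j_ge3 lt_j} Yj => // j _ Yj; epos.
  by rewrite En !subSS subn0 in sum_pos *; epos.
rewrite twinned_quarter_rec // Yz.
have [m ->] : exists m, n = m.+4.+2.
  by exists (n - 6)%N; rewrite -[_.+4.+2]/(6 + _)%N subnKC.
rewrite !addn1 !addn2 !subSS !subn0; ring.
Qed.

(** * Initial values, recurrence and e-positivity *)

Theorem proposition4p3 :
  [/\ \XP_2 = 24%:R * \e_4,
      \XP_3 = 4%:R * \e_3 * \e_2 + 12%:R * \e_4 * \e_1 + 20%:R * \e_5,
      \XP_4 = 24%:R * \e_3 ^+ 2 + 8%:R * \e_4 * \e_2 + 16%:R * \e_5 * \e_1
              + 24%:R * \e_6 &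
      \XP_5 = 16%:R * \e_3 * \e_3 * \e_1 + 68%:R * \e_4 * \e_3
              + 12%:R * \e_5 * \e_2 + 20%:R * \e_6 * \e_1 + 28%:R * \e_7]
  /\
  forall n : nat, (6 <= n)%N ->
    let quarter : rat := 4%:R^-1 in
    let rhs : symfun :=
      quarter *: (\sum_(3 <= j < n - 2) (j - 1)%:R * \e_j * \XP_(n - j))
      + (n + 2)%:R * \e_(n + 2)
      + n%:R * \e_(n + 1) * \e_1
      + (3 * (n - 2))%:R * \e_(n - 1) * \e_3
      + (2 * (n - 3))%:R * \e_(n - 2) * \e_3 * \e_1
      + (4 * (n - 3))%:R * \e_(n - 2) * \e_4
      + \e_2 * (quarter *: \XP_(n - 2)
                - 2%:R * \e_n
                - (n - 4)%:R * \e_(n - 2) * \e_2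
                - (n - 2)%:R * \e_(n - 1) * \e_1) in
    quarter *: \XP_n = rhs /\ e_positive rhs.
Proof.
split.
  split; first exact: chromatic_sf_twinned_path2.
  - by rewrite chromatic_sf_twinned_path // twinned_quarter3; ring.
  - by rewrite chromatic_sf_twinned_path // twinned_quarter4; ring.
  - by rewrite chromatic_sf_twinned_path // twinned_quarter5; ring.
move=> n n_ge6 quarter rhs.
have n_ge3 : (3 <= n)%N by exact: leq_trans n_ge6.
have quarterE k : (3 <= k)%N -> quarter *: \XP_k = twinned_quarter k.
  by move=> k_ge3; rewrite chromatic_sf_twinned_path // scale_quarter.
(* Every twinned path on the right has an index of at least 3, since j < n - 2 and $n \ge 6$, so
   [quarterE] applies to each. *)
have rhsE : rhs = twinned_quarter n.
  rewrite twinned_quarter_rec // /rhs quarterE; last first.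
    by rewrite leq_subRL ?(leq_trans _ n_ge6) // (leq_trans _ n_ge6).
  do 6!congr (_ + _); rewrite scaler_sumr.
  apply: eq_big_nat => j /andP[j_ge3 lt_j].
  by rewrite scalerAr quarterE // ltn_subRL addnC -ltn_subRL.
split; first by rewrite rhsE quarterE.
rewrite rhsE; have [z z_pos ->] := twinned_quarter_e_positive n_ge3.
by case: n n_ge3 {n_ge6 rhs rhsE} => // n _; rewrite addn1 addn2; epos.
Qed.
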